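(* Consider Algorithm SGM (described in the context) applied to $\min\{f(x): x\in C\}$, and assume that $\lim_{k\to+\infty}\nu_k=0$. Then the algorithm either stops in a finite number of iterations at a stationary point of the problem $\min\{f(x):x\in C\}$, or generates an infinite sequence $(x^k)_{k\in\mathbb{N}}$ for which every cluster point is stationary for this problem.
   Context: Notation: $\mathbb{N}=\{0,1,2,\ldots\}$; $\langle\cdot,\cdot\rangle$ and $\|\cdot\|$ are the Euclidean inner product and norm on $\mathbb{R}^n$. $C\subseteq\mathbb{R}^n$ is nonempty, closed and convex, $f:\mathbb{R}^n\to\mathbb{R}$ is continuously differentiable, and the solution set $\Omega^*$ of $\min\{f(x):x\in C\}$ is assumed nonempty. A point $\bar x\in C$ is stationary for this problem if $\langle\nabla f(\bar x),x-\bar x\rangle\ge 0$ for all $x\in C$. For $\mu\ge 1$, $\mathcal{D}_\mu$ is the set of symmetric positive definite $n\times n$ matrices with all eigenvalues in $[1/\mu,\mu]$. For $D\in\mathcal{D}_\mu$, $\|d\|_D:=\sqrt{\langle Dd,d\rangle}$ and $\mathcal{P}_C^D(v):=\arg\min_{z\in C}\|z-v\|_D^2$. For $u\in C$, $v\in\mathbb{R}^n$, $\zeta\in(0,1]$, $$\mathcal{P}_{C,\zeta}^D(u,v):=\{w\in C:\ \|w-v\|_D^2\le\zeta\|\mathcal{P}_C^D(v)-v\|_D^2+(1-\zeta)\|u-v\|_D^2\}.$$ Algorithm SGM. Step 0: choose $\sigma,\zeta_{\min}\in(0,1)$, $\delta_{\min}\in[0,1)$, $0<\underline\omega<\bar\omega<1$,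 $0<\alpha_{\min}\le\alpha_{\max}$, $\mu\ge1$, $x^0\in C$, $\nu_0\ge0$; set $k=0$. Step 1: choose $\alpha_k\in[\alpha_{\min},\alpha_{\max}]$, $\zeta_k$ with $0<\zeta_{\min}<\zeta_k\le1$, and $D_k\in\mathcal{D}_\mu$. Set $z^k:=x^k-\alpha_kD_k^{-1}\nabla f(x^k)$ and take any $w^k\in\mathcal{P}_{C,\zeta_k}^{D_k}(x^k,z^k)$. If $w^k=x^k$, stop (at $x^k$). Step 2: set $\tau_{\rm trial}=1$. If $f(x^k+\tau_{\rm trial}(w^k-x^k))\le f(x^k)+\sigma\tau_{\rm trial}\langle\nabla f(x^k),w^k-x^k\rangle+\nu_k$, set $\tau_k=\tau_{\rm trial}$, $x^{k+1}=x^k+\tau_k(w^k-x^k)$ and go to Step 3. Otherwise choose $\tau_{\rm new}\in[\underline\omega\tau_{\rm trial},\bar\omega\tau_{\rm trial}]$, set $\tau_{\rm trial}=\tau_{\rm new}$ and repeat the test. Step 3: take $\delta_{k+1}\in[\delta_{\min},1]$ and choose $\nu_{k+1}$ with $0\le\nu_{k+1}\le(1-\delta_{k+1})[f(x^k)+\nu_k-f(x^{k+1})]$. Set $k\leftarrow k+1$ and go to Step 1. *)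

(* Defs.v *)
From HB Require Import structures.
From mathcomp Require Import all_boot all_order all_algebra.
From mathcomp Require Import all_classical all_reals all_analysis.
Import Order.TTheory GRing.Theory Num.Theory.
Import numFieldNormedType.Exports.

Set Implicit Arguments.
Unset Strict Implicit.
Unset Printing Implicit Defensive.

Local Open Scope classical_set_scope.
Local Open Scope ring_scope.

(* Points of R^n are row vectors, so the image of d under a matrix D is
   d *m D^T, i.e. d *m D for the symmetric matrices used here.  The topology
   of 'rV[R]_n is the usual one of R^n; its library norm `|x| is the sup norm,
   hence the explicit Euclidean structure below. *)

Definition dotp (R : realType) (n : nat) (u v : 'rV[R]_n) : R :=
  \sum_(i < n) u 0 i * v 0 i.

Definition gradient (R : realType) (n : nat) (f : 'rV[R]_n -> R)
    (x : 'rV[R]_n) : 'rV[R]_n :=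
  \row_(i < n) 'D_(delta_mx 0 i) f x.

Definition continuously_differentiable (R : realType) (n : nat)
    (f : 'rV[R]_n -> R) : Prop :=
  (forall x, differentiable f x) /\ continuous (gradient f).

Definition argmin (R : realType) (T : Type) (g : T -> R) (C : set T) : set T :=
  [set z | C z /\ forall y, C y -> g z <= g y].

Definition stationary (R : realType) (n : nat) (C : set 'rV[R]_n)
    (f : 'rV[R]_n -> R) (xbar : 'rV[R]_n) : Prop :=
  C xbar /\ forall x, C x -> 0 <= dotp (gradient f xbar) (x - xbar).

Definition posdefmx (R : realType) (n : nat) (D : 'M[R]_n) : Prop :=
  D^T = D /\ forall d : 'rV[R]_n, d != 0 -> 0 < dotp (d *m D) d.

(* A real symmetric matrix has only real eigenvalues, so it is enough to range
   over a : R. *)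
Definition Dset (R : realType) (n : nat) (mu : R) : set 'M[R]_n :=
  [set D | posdefmx D /\ forall a : R, eigenvalue D a -> mu^-1 <= a <= mu].

Definition normD (R : realType) (n : nat) (D : 'M[R]_n) (d : 'rV[R]_n) : R :=
  Num.sqrt (dotp (d *m D) d).

(* For C nonempty closed convex and D positive definite the set of minimizers
   is a singleton, and get returns its element. *)
Definition proj (R : realType) (n : nat) (C : set 'rV[R]_n) (D : 'M[R]_n)
    (v : 'rV[R]_n) : 'rV[R]_n :=
  get (argmin (fun z => normD D (z - v) ^+ 2) C).

Definition inexact_proj (R : realType) (n : nat) (C : set 'rV[R]_n)
    (D : 'M[R]_n) (zeta : R) (u v : 'rV[R]_n) : set 'rV[R]_n :=
  [set w | C w /\
    normD D (w - v) ^+ 2 <= zeta * normD D (proj C D v - v) ^+ 2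
                            + (1 - zeta) * normD D (u - v) ^+ 2].

Record sgm_params (R : realType) := SGMParams {
  sigma : R;
  zeta_min : R;
  delta_min : R;
  omega_lo : R;
  omega_hi : R;
  alpha_min : R;
  alpha_max : R;
  mu : R }.

Definition sgm_params_ok (R : realType) (p : sgm_params R) : Prop :=
  [/\ 0 < sigma p < 1, 0 < zeta_min p < 1, 0 <= delta_min p < 1,
      [/\ 0 < omega_lo p, omega_lo p < omega_hi p & omega_hi p < 1]
    & [/\ 0 < alpha_min p, alpha_min p <= alpha_max p & 1 <= mu p]].

(* Control states.  AtStep1 k x nu: the k-th iteration starts with x^k = x and
   nu_k = nu.  AtStep2 k x nu w tau: the line search of the k-th iteration is
   about to test tau_trial = tau.  AtStep3 k x nu y: the line search has
   produced x^{k+1} = y.  Stopped k x: the algorithm stopped at x^k = x. *)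
Inductive sgm_state (R : realType) (n : nat) : Type :=
| AtStep1 of nat & 'rV[R]_n & R
| AtStep2 of nat & 'rV[R]_n & R & 'rV[R]_n & R
| AtStep3 of nat & 'rV[R]_n & R & 'rV[R]_n
| Stopped of nat & 'rV[R]_n.
Arguments AtStep1 {R n}.
Arguments AtStep2 {R n}.
Arguments AtStep3 {R n}.
Arguments Stopped {R n}.

Definition step1_choice (R : realType) (n : nat) (C : set 'rV[R]_n)
    (f : 'rV[R]_n -> R) (p : sgm_params R) (x w : 'rV[R]_n) : Prop :=
  exists (alpha zeta : R) (D : 'M[R]_n),
    [/\ alpha_min p <= alpha <= alpha_max p,
        zeta_min p < zeta <= 1,
        Dset (mu p) D
      & inexact_proj C D zeta x (x - alpha *: (gradient f x *m invmx D)) w].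

Definition linesearch_test (R : realType) (n : nat) (f : 'rV[R]_n -> R)
    (p : sgm_params R) (x : 'rV[R]_n) (nu : R) (w : 'rV[R]_n) (tau : R) : bool :=
  f (x + tau *: (w - x))
    <= f x + sigma p * tau * dotp (gradient f x) (w - x) + nu.

Variant sgm_step (R : realType) (n : nat) (C : set 'rV[R]_n)
    (f : 'rV[R]_n -> R) (p : sgm_params R) :
    sgm_state R n -> sgm_state R n -> Prop :=
| SGM_stop k x nu w :
    step1_choice C f p x w -> w = x ->
    sgm_step C f p (AtStep1 k x nu) (Stopped k x)
| SGM_direction k x nu w :
    step1_choice C f p x w -> w <> x ->
    sgm_step C f p (AtStep1 k x nu) (AtStep2 k x nu w 1)
| SGM_accept k x nu w tau :
    linesearch_test f p x nu w tau ->
    sgm_step C f p (AtStep2 k x nu w tau)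
                   (AtStep3 k x nu (x + tau *: (w - x)))
| SGM_backtrack k x nu w tau tau_new :
    ~~ linesearch_test f p x nu w tau ->
    omega_lo p * tau <= tau_new <= omega_hi p * tau ->
    sgm_step C f p (AtStep2 k x nu w tau) (AtStep2 k x nu w tau_new)
| SGM_update k x nu y delta nu_new :
    delta_min p <= delta <= 1 ->
    0 <= nu_new <= (1 - delta) * (f x + nu - f y) ->
    sgm_step C f p (AtStep3 k x nu y) (AtStep1 k.+1 y nu_new).

(* Maximal executions: s stays in its current state only when no step of the
   algorithm is possible from there (the case of Stopped).  In particular an
   execution in which some line search never accepts a trial value is not
   excluded by definition. *)
Definition sgm_execution (R : realType) (n : nat) (C : set 'rV[R]_n)
    (f : 'rV[R]_n -> R) (p : sgm_params R) (x0 : 'rV[R]_n) (nu0 : R)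
    (s : nat -> sgm_state R n) : Prop :=
  s 0%N = AtStep1 0 x0 nu0 /\
  forall i, sgm_step C f p (s i) (s i.+1) \/
            (s i.+1 = s i /\ forall t, ~ sgm_step C f p (s i) t).

(* The execution s performs infinitely many iterations and x, nu are the
   sequences (x^k) and (nu_k) it produces; they are determined by s, since the
   iteration counter increases each time Step 1 is entered. *)
Definition sgm_generates (R : realType) (n : nat) (s : nat -> sgm_state R n)
    (x : nat -> 'rV[R]_n) (nu : nat -> R) : Prop :=
  forall k, exists i, s i = AtStep1 k (x k) (nu k).

(* Main.v *)
Require Import Defs.
From mathcomp Require Import all_boot all_order all_algebra.
From mathcomp Require Import all_classical all_reals all_analysis.
From mathcomp Require Import ring lra.
Import Order.TTheory GRing.Theory Num.Theory.
Import numFieldNormedType.Exports.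
Set Implicit Arguments.
Unset Strict Implicit.
Unset Printing Implicit Defensive.

Local Open Scope classical_set_scope.
Local Open Scope ring_scope.

(** Write g for the gradient of f, d = w^k - x^k.  Expanding the inexactness
    criterion around x^k and comparing the exact projection with an arbitrary
    y in C gives the single inequality
      |d|_D^2 + 2 alpha <g, d> <= zeta (|y - x^k|_D^2 + 2 alpha <g, y - x^k>).
    With y = x^k it yields descent and a bound on |d|; if w^k = x^k it yields
    stationarity by letting y tend to x^k along segments; and if some y makes
    <g(xbar), y - xbar> < 0 it yields <g, d> <= - eta uniformly for x^k near
    xbar.  As f(x^k) + nu_k is nonincreasing and nu_k tends to 0, tau_k <g, d>
    tends to 0, so near such an xbar the steps tau_k are eventually small and a
    nearby trial step was rejected; the mean value theorem at that trial
    contradicts <g, d> <= - eta.  Working with neighbourhoods of xbar avoids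
    extracting subsequences of w^k, alpha_k and D_k. *)

(** * Inner products, the sup norm and limits of quadratic forms *)

Section InnerProduct.
Context {R : realType} {n : nat}.
Implicit Types (u v w : 'rV[R]_n) (D : 'M[R]_n) (a : R).

Lemma dotpC u v : dotp u v = dotp v u.
Proof. by apply: eq_bigr => i _; rewrite mulrC. Qed.

Lemma dotpDl u v w : dotp (u + v) w = dotp u w + dotp v w.
Proof. by rewrite -big_split; apply: eq_bigr => i _; rewrite mxE mulrDl. Qed.

Lemma dotpZl a u v : dotp (a *: u) v = a * dotp u v.
Proof. by rewrite mulr_sumr; apply: eq_bigr => i _; rewrite mxE mulrA. Qed.

Lemma dotpNl u v : dotp (- u) v = - dotp u v.
Proof. by rewrite -scaleN1r dotpZl mulN1r. Qed.

Lemma dotpDr u v w : dotp w (u + v) = dotp w u + dotp w v.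
Proof. by rewrite dotpC dotpDl !(dotpC w). Qed.

Lemma dotpZr a u v : dotp u (a *: v) = a * dotp u v.
Proof. by rewrite dotpC dotpZl dotpC. Qed.

Lemma dotpNr u v : dotp u (- v) = - dotp u v.
Proof. by rewrite dotpC dotpNl dotpC. Qed.

Lemma dotp0r u : dotp u 0 = 0.
Proof. by rewrite -(scale0r 0) dotpZr mul0r. Qed.

Lemma dotp_mulmx u v D : dotp (u *m D) v = dotp u (v *m D^T).
Proof.
rewrite /dotp; under eq_bigr do rewrite mxE mulr_suml.
rewrite exchange_big; apply: eq_bigr => i _; rewrite mxE mulr_sumr.
by apply: eq_bigr => j _; rewrite mxE mulrA mulrAC.
Qed.

Lemma dotpp_ge0 u : 0 <= dotp u u.
Proof. by apply: sumr_ge0 => i _; rewrite -expr2 sqr_ge0. Qed.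

Lemma mx_coord_le_norm u i : `|u 0 i| <= `|u|.
Proof.
rewrite [leRHS]/Num.norm/= mx_normrE; apply/bigmax_geP; right.
by exists (0, i).
Qed.

(** The sup norm is attained at a coordinate, whose square is one of the nonnegative terms of the
    sum. *)
Lemma sqr_norm_le_dotp u : `|u| ^+ 2 <= dotp u u.
Proof.
have [->|u0] := eqVneq u 0; first by rewrite normr0 expr0n dotpp_ge0.
have [|[i j] /= E] := @mx_norm_neq0 R 1 n u.
  by apply: contra u0 => /eqP/mx_norm_eq0 ->.
have -> : `|u| = `|u i j| by [].
rewrite ord1 real_normK ?num_real// /dotp (bigD1 j)//= -expr2 lerDl.
by apply: sumr_ge0 => k _; rewrite -expr2 sqr_ge0.
Qed.

Lemma dotpp_eq0 u : (dotp u u == 0) = (u == 0).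
Proof.
apply/eqP/eqP => [u0|->]; last by rewrite dotp0r.
have := sqr_norm_le_dotp u; rewrite u0 => h.
apply/eqP; rewrite -normr_eq0 -sqrf_eq0; apply/eqP/le_anti.
by rewrite h sqr_ge0.
Qed.

Lemma dotpp_gt0 u : u != 0 -> 0 < dotp u u.
Proof. by move=> u0; rewrite lt0r dotpp_eq0 u0 dotpp_ge0. Qed.

Lemma norm_dotp_le u v : `|dotp u v| <= n%:R * `|u| * `|v|.
Proof.
apply: (le_trans (ler_norm_sum _ _ _)).
apply: (@le_trans _ _ (\sum_(i < n) `|u| * `|v|)).
  by apply: ler_sum => i _; rewrite normrM ler_pM// mx_coord_le_norm.
by rewrite sumr_const card_ord mulr_natl mulrnAl.
Qed.

Lemma cvg_sumr (T : Type) (F : set_system T) (FF : Filter F) (I : Type)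
    (r : seq I) (g : I -> T -> R) (l : I -> R) :
  (forall i, g i @ F --> l i) ->
  \sum_(i <- r) g i x @[x --> F] --> \sum_(i <- r) l i.
Proof.
move=> gl; elim: r => [|i r IH].
  by rewrite big_nil; under eq_fun do rewrite big_nil; exact: cvg_cst.
rewrite big_cons; under eq_fun do rewrite big_cons.
by apply: cvgD; [exact: gl | exact: IH].
Qed.

(** An arbitrary filter and two maps cover continuity at a point, limits along segments and, with
    identity [D], plain inner products. *)
Lemma cvg_qform (T : Type) (F : set_system T) (FF : Filter F)
    (g h : T -> 'rV[R]_n) D u v :
  g @ F --> u -> h @ F --> v ->
  dotp (g x *m D) (h x) @[x --> F] --> dotp (u *m D) v.
Proof.
have coord (k : T -> 'rV[R]_n) w i : k @ F --> w -> k x 0 i @[x --> F] --> w 0 i.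
  move=> kw; apply: (@cvg_comp _ _ _ k (fun M : 'rV[R]_n => M 0 i) _ _ _ kw).
  exact: coord_continuous.
move=> gu hv; apply: cvg_sumr => i; apply: cvgM; last exact: coord.
rewrite mxE; under eq_fun do rewrite mxE.
apply: (@cvg_sumr _ _ FF _ _ (fun j x => g x 0 j * D j i)
  (fun j => u 0 j * D j i)) => j.
by apply: cvgM; [exact: coord | exact: cvg_cst].
Qed.

Lemma continuous_qform D v : continuous (fun u => dotp ((u - v) *m D) (u - v)).
Proof.
move=> u; have h : (fun w => w - v) @ nbhs u --> u - v.
  by apply: (@continuousB _ 'rV[R]_n _ id (cst v) u) => //; exact: cst_continuous.
exact: (@cvg_qform _ (nbhs u)).
Qed.

Lemma cvg_dotp (T : Type) (F : set_system T) (FF : Filter F)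
    (g h : T -> 'rV[R]_n) u v :
  g @ F --> u -> h @ F --> v -> dotp (g x) (h x) @[x --> F] --> dotp u v.
Proof.
move=> gu hv; rewrite -(mulmx1 u); under eq_fun do rewrite -(mulmx1 (g _)).
exact: cvg_qform.
Qed.

End InnerProduct.

(** Dividing by [t] and letting it tend to 0 is replaced by one explicit value. *)
Lemma quadratic_ge0_linear_ge0 {R : realFieldType} (a b : R) :
  (forall t, 0 < t <= 1 -> 0 <= t * b + t ^+ 2 * a) -> 0 <= b.
Proof.
move=> h; rewrite leNgt; apply/negP => b0.
have c0 : 0 < `|a| - b + 1 by have := normr_ge0 a; lra.
(* This value gives [t * |a| = - b - t * (1 - b)], so [b + t * a <= - t * (1 - b) < 0]. *)
pose t := (- b) / (`|a| - b + 1).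
have tE : t * (`|a| - b + 1) = - b by rewrite divfK// gt_eqF.
have t0 : 0 < t by rewrite divr_gt0// oppr_gt0.
have t1 : t <= 1 by rewrite ler_pdivrMr// mul1r; have := normr_ge0 a; lra.
have := h t; rewrite t0 t1 expr2 -mulrA -mulrDr pmulr_rge0// => /(_ isT).
have := ler_norm a; have := normr_ge0 a; nra.
Qed.

(** * Rayleigh quotients and the largest eigenvalue *)

Section Rayleigh.
Context {R : realType} {n : nat}.
Implicit Types (u v w : 'rV[R]_n) (D : 'M[R]_n) (a : R).

(** The growth condition bounds the sublevel set. It is used for the unit sphere and for the
    distance minimized by a projection. *)
Lemma compact_sublevel (C : set 'rV[R]_n) (phi : 'rV[R]_n -> R) v a b :
  closed C -> continuous phi -> (forall z, dotp (z - v) (z - v) <= b * phi z) ->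
  0 <= b -> compact (C `&` [set z | phi z <= a]).
Proof.
move=> clC cphi hphi b0; apply: bounded_closed_compact.
  exists (`|v| + 1 + b * a); split; first exact: num_real.
  move=> M ltM z [_ /= za]; apply/ltW/(le_lt_trans _ ltM).
  have h := hphi z; have h1 := sqr_norm_le_dotp (z - v).
  have h2 : b * phi z <= b * a by rewrite ler_wpM2l.
  have h3 : `|z| <= `|v| + `|z - v|.
    by rewrite (le_trans _ (ler_normD _ _))// addrC subrK.
  suff : `|z - v| <= 1 + b * a by lra.
  (* With [u = |z - v|], [2 * u <= 1 + u ^ 2 <= 1 + b * a] avoids a square root. *)
  by have := sqr_ge0 (`|z - v| - 1); nra.
apply: closedI => //.
by apply: (@closed_comp _ _ phi [set x | x <= a]) => // x _; exact: cphi.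
Qed.

(** At [v + t *: u] the form is a quadratic in [t] without constant term, so its linear coefficient
    [2 <v D, u>] is nonnegative for every [u], in particular for [u = - v D]. *)
Lemma psd_kernel D v : D^T = D -> (forall u, 0 <= dotp (u *m D) u) ->
  dotp (v *m D) v = 0 -> v *m D = 0.
Proof.
move=> symD psd v0.
have key u : 0 <= dotp (v *m D) u.
  rewrite -(pmulr_rge0 _ (ltr0n R 2)).
  apply: (@quadratic_ge0_linear_ge0 _ (dotp (u *m D) u)) => t _.
  have := psd (v + t *: u).
  rewrite mulmxDl -scalemxAl !(dotpDl, dotpDr, dotpZl, dotpZr) v0.
  by rewrite (dotp_mulmx u) symD (dotpC u) => /le_trans; apply; lra.
apply/eqP; rewrite -dotpp_eq0; apply/eqP/le_anti; rewrite dotpp_ge0 andbT.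
by have := key (- (v *m D)); rewrite dotpNr oppr_ge0.
Qed.

(** If [v] maximizes the form on the unit sphere with value [a], then [a I - D] is positive
    semidefinite and its form vanishes at [v]; so [v] lies in its kernel and is an eigenvector of
    [D]. *)
Lemma rayleigh_le_eigenvalue D : D^T = D -> (0 < n)%N ->
  exists a, eigenvalue D a /\ forall u, dotp (u *m D) u <= a * dotp u u.
Proof.
move=> symD n0.
pose S := [set u : 'rV[R]_n | dotp u u = 1].
have cdot : continuous (fun u : 'rV[R]_n => dotp u u).
  by move=> u; exact: (@cvg_dotp R n _ (nbhs u) _ id id u u).
have clS : closed S.
  apply: (@closed_comp _ _ (fun u : 'rV[R]_n => dotp u u) [set 1]) => [x _|].
    exact: cdot.
  exact: closed_eq.
have cS : compact S.
  have -> : S = S `&` [set u | dotp u u <= 1].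
    by apply/seteqP; split => [u|u []//]; rewrite /S/= => ->.
  apply: (@compact_sublevel _ _ 0 _ 1) => // u; rewrite ?ler01//.
  by rewrite subr0 mul1r.
have normalize u : u != 0 -> S ((Num.sqrt (dotp u u))^-1 *: u).
  move=> u0; rewrite /S/= dotpZl dotpZr mulrA -invfM -expr2 sqr_sqrtr ?dotpp_ge0//.
  by rewrite mulVf// dotpp_eq0.
have S0 : S !=set0.
  have e0 : (const_mx 1 : 'rV[R]_n) != 0.
    apply/eqP => /rowP /(_ (Ordinal n0)); rewrite !mxE => /eqP.
    by rewrite oner_eq0.
  by eexists; exact: normalize e0.
have [|v vS vmax] := @EVT_max_rV R n (fun u => dotp (u *m D) u) S S0 cS.
  by apply: continuous_subspaceT => u; exact: (@cvg_qform R n _ (nbhs u) _ id id D u u).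
rewrite inE in vS.
pose a := dotp (v *m D) v.
have le_a u : dotp (u *m D) u <= a * dotp u u.
  have [->|u0] := eqVneq u 0; first by rewrite !dotp0r mulr0.
  have := vmax _ (mem_set (normalize _ u0)); rewrite -/a -scalemxAl dotpZl dotpZr.
  by rewrite mulrA -invfM -expr2 sqr_sqrtr ?dotpp_ge0// ler_pdivrMl ?dotpp_gt0// mulrC.
exists a; split=> //; apply/eigenvalueP; exists v; last first.
  by apply/eqP => v0; move: vS; rewrite /S/= v0 dotp0r => /esym/eqP; rewrite oner_eq0.
have B u : dotp (u *m (a%:M - D)) u = a * dotp u u - dotp (u *m D) u.
  by rewrite mulmxBr mul_mx_scalar dotpDl dotpNl dotpZl.
have := @psd_kernel (a%:M - D) v.
rewrite mulmxBr mul_mx_scalar => h; apply/eqP; rewrite eq_sym -subr_eq0; apply/eqP/h.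
- by rewrite linearB/= tr_scalar_mx symD.
- by move=> u; rewrite B subr_ge0.
- by rewrite -mul_mx_scalar -mulmxBr B vS mulr1 subrr.
Qed.

End Rayleigh.

(** * Spectral bounds and scaled projections *)

Section SpectralBounds.
Context {R : realType} {n : nat}.
Implicit Types (u v w : 'rV[R]_n) (D : 'M[R]_n).

(** The upper bound is the Rayleigh bound for [D], the lower one that for [- D]. Dimension 0 is
    separate, as the unit sphere is then empty. *)
Lemma Dset_qform_bounds (m : R) D u : Dset m D ->
  m^-1 * dotp u u <= dotp (u *m D) u <= m * dotp u u.
Proof.
move=> [[symD _] eigD].
have [n0|] := posnP n.
  have -> : u = 0 by apply/rowP => -[i lti]; exfalso; rewrite n0 in lti.
  by rewrite !dotp0r !mulr0 lexx.
move=> n0; have u0 := dotpp_ge0 u; apply/andP; split.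
- have [|a [/eigenvalueP[v /eqP va v0] ha]] := @rayleigh_le_eigenvalue R n (- D) _ n0.
    by rewrite linearN/= symD.
  have /eigD/andP[+ _] : eigenvalue D (- a).
    apply/eigenvalueP; exists v => //.
    by apply/eqP; move: va; rewrite mulmxN scaleNr eqr_oppLR.
  by have := ha u; rewrite mulmxN dotpNl; nra.
- have [a [/eigD/andP[_ am] ha]] := rayleigh_le_eigenvalue symD n0.
  by rewrite (le_trans (ha u))// ler_wpM2r.
Qed.

Lemma posdefmx_unitmx D : posdefmx D -> D \in unitmx.
Proof.
move=> [_ pD]; rewrite -row_free_unit -kermx_eq0; apply/negPn/negP.
move=> /rowV0Pn[v /sub_kermxP vD /pD]; rewrite vD.
by rewrite dotpC dotp0r ltxx.
Qed.

Lemma dotp_mulmx_invmx D u v : posdefmx D ->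
  dotp (u *m D) (v *m invmx D) = dotp u v.
Proof.
by move=> pD; rewrite dotp_mulmx pD.1 mulmxKV// posdefmx_unitmx.
Qed.

Lemma normD_sqr D u : posdefmx D -> normD D u ^+ 2 = dotp (u *m D) u.
Proof.
move=> pD; rewrite sqr_sqrtr//.
by have [->|/pD.2/ltW//] := eqVneq u 0; rewrite dotp0r.
Qed.

Lemma dotp_qformD D u v : posdefmx D ->
  dotp ((u + v) *m D) (u + v)
  = dotp (u *m D) u + 2 * dotp (u *m D) v + dotp (v *m D) v.
Proof.
move=> pD; rewrite mulmxDl !(dotpDl, dotpDr) (dotp_mulmx v u) pD.1.
by rewrite (dotpC v); ring.
Qed.

(** [proj] is chosen by [get], so a minimizer has to be exhibited: the lower spectral bound makes
    the sublevel set through a point of [C] compact. *)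
Lemma proj_argmin (C : set 'rV[R]_n) (m : R) D v :
  C !=set0 -> closed C -> 0 < m -> Dset m D ->
  argmin (fun z => normD D (z - v) ^+ 2) C (Defs.proj C D v).
Proof.
move=> [c Cc] clC m0 DD; have pD := DD.1; apply: getPex.
pose phi (z : 'rV[R]_n) := dotp ((z - v) *m D) (z - v).
have cphi : continuous phi by exact: continuous_qform.
have cS : compact (C `&` [set z | phi z <= phi c]).
  apply: (@compact_sublevel _ _ _ _ v _ m) => //; last exact: ltW.
  move=> z.
  have /andP[+ _] := Dset_qform_bounds (z - v) DD.
  by rewrite /= ler_pdivrMl.
have [||z zS zmin] := @EVT_min_rV R n phi _ _ cS.
- by exists c; split => /=.
- exact: continuous_subspaceT.
rewrite inE in zS; exists z; split; first exact: zS.1.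
move=> y Cy; rewrite !normD_sqr//.
have [yc|/ltW cy] := leP (phi y) (phi c).
  by apply: zmin; rewrite inE; split.
exact: le_trans zS.2 cy.
Qed.

(* Expanding both distances around [x] cancels the [D]-norm of the step
   [alpha *: (g *m invmx D)], and comparing the exact projection with [y]
   eliminates the projection altogether. *)
Lemma inexact_proj_le (C : set 'rV[R]_n) (m zeta alpha : R) D x g w y :
  closed C -> 0 < m -> Dset m D -> 0 <= zeta -> C y ->
  inexact_proj C D zeta x (x - alpha *: (g *m invmx D)) w ->
  dotp ((w - x) *m D) (w - x) + 2 * alpha * dotp g (w - x)
  <= zeta * (dotp ((y - x) *m D) (y - x) + 2 * alpha * dotp g (y - x)).
Proof.
move=> clC m0 DD zeta0 Cy [Cw]; have pD := DD.1.
set z := alpha *: _; have := (proj_argmin (x - z) (ex_intro _ y Cy) clC m0 DD).2 y Cy.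
set P := normD D (Defs.proj _ _ _ - _) ^+ 2.
have E u : normD D (u - (x - z)) ^+ 2
    = dotp ((u - x) *m D) (u - x) + 2 * alpha * dotp g (u - x) + dotp (z *m D) z.
  have -> : u - (x - z) = (u - x) + z by rewrite opprB addrCA addrC.
  rewrite normD_sqr// dotp_qformD//.
  by rewrite {1}/z dotpZr dotp_mulmx_invmx// (dotpC g) mulrA.
rewrite !E subrr mul0mx !dotp0r; nra.
Qed.

End SpectralBounds.

(** * Properties of the points allowed by Step 1 *)

Section Step1.
Context {R : realType} {n : nat}.
Context {C : set 'rV[R]_n} {f : 'rV[R]_n -> R} {p : sgm_params R}.
Hypothesis clC : closed C.
Hypothesis p_ok : sgm_params_ok p.
Implicit Types x w y : 'rV[R]_n.

(** The exact Euclidean projection with [zeta = 1] is admissible, so Step 1 never blocks. *)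
Lemma step1_choice_exists x : C x -> exists w, step1_choice C f p x w.
Proof.
have [_ /andP[_ z1] _ _ [a0 a1 m1]] := p_ok.
have m0 : 0 < mu p by rewrite (lt_le_trans _ m1).
move=> Cx; have D1 : Dset (mu p) (1%:M : 'M[R]_n).
  split; first by split=> [|d d0]; rewrite ?trmx1// mulmx1 dotpp_gt0.
  move=> a /eigenvalueP[v]; rewrite mulmx1 => /eqP.
  rewrite -{1}(scale1r v) -subr_eq0 -scalerBl scaler_eq0 => /orP[|->//].
  by rewrite subr_eq0 => /eqP <- _; rewrite invf_le1// m1.
pose v := x - alpha_min p *: (gradient f x *m invmx 1%:M).
have [Cw _] := proj_argmin v (ex_intro _ x Cx) clC m0 D1.
exists (Defs.proj C 1%:M v); exists (alpha_min p), 1, 1%:M; split => //.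
- by rewrite lexx.
- by rewrite z1 lexx.
- by split => //; rewrite mul1r subrr mul0r addr0.
Qed.

Lemma step1_choice_in x w : step1_choice C f p x w -> C w.
Proof. by move=> [? [? [? [_ _ _ []]]]]. Qed.

(** The spectral bounds remove [D] from the inequality, leaving only [alpha] and [zeta], which are
    confined to fixed intervals. *)
Lemma step1_choice_le x w y : C y -> step1_choice C f p x w ->
  exists alpha zeta, [/\ alpha_min p <= alpha <= alpha_max p,
    zeta_min p < zeta <= 1 &
    (mu p)^-1 * dotp (w - x) (w - x) + 2 * alpha * dotp (gradient f x) (w - x)
    <= zeta * (mu p * dotp (y - x) (y - x)
               + 2 * alpha * dotp (gradient f x) (y - x))].
Proof.
have [_ /andP[z0 _] _ _ [_ _ m1]] := p_ok.
have m0 : 0 < mu p by rewrite (lt_le_trans _ m1).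
move=> Cy [alpha [zeta [D [ha hz DD hw]]]]; exists alpha, zeta; split => //.
have z0' : 0 <= zeta by rewrite ltW// (lt_trans z0)//; case/andP: hz.
have := inexact_proj_le clC m0 DD z0' Cy hw.
have /andP[+ _] := Dset_qform_bounds (w - x) DD.
have /andP[_ +] := Dset_qform_bounds (y - x) DD.
nra.
Qed.

(** The comparison point [y = x] makes the right-hand side vanish. *)
Lemma step1_choice_sqr_le x w : C x -> step1_choice C f p x w ->
  exists alpha, alpha_min p <= alpha <= alpha_max p /\
    (mu p)^-1 * dotp (w - x) (w - x) <= - (2 * alpha * dotp (gradient f x) (w - x)).
Proof.
move=> Cx /(step1_choice_le Cx)[alpha [zeta [ha _ hle]]]; exists alpha.
by split => //; move: hle; rewrite subrr !dotp0r !mulr0 addr0 mulr0 -lerBrDr sub0r.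
Qed.

Lemma step1_choice_descent x w : C x -> step1_choice C f p x w -> w <> x ->
  dotp (gradient f x) (w - x) < 0.
Proof.
have [_ _ _ _ [a0 _ m1]] := p_ok.
have m0 : 0 < (mu p)^-1 by rewrite invr_gt0 (lt_le_trans _ m1).
move=> Cx /(step1_choice_sqr_le Cx)[alpha [/andP[aa _]]] + /eqP.
rewrite -subr_eq0 => + /dotpp_gt0 => + h.
have : 0 < (mu p)^-1 * dotp (w - x) (w - x) by rewrite mulr_gt0.
nra.
Qed.

(** The quadratic bound and [norm_dotp_le] bound [|d| ^ 2] by a multiple of [|g| |d|]; after
    division by [|d|], directions are bounded wherever the gradient is. *)
Lemma step1_choice_norm_le x w : C x -> step1_choice C f p x w ->
  `|w - x| <= 2 * mu p * alpha_max p * n%:R * `|gradient f x|.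
Proof.
have [_ _ _ _ [a0 a1 m1]] := p_ok.
have m0 : 0 < mu p by rewrite (lt_le_trans _ m1).
move=> Cx /(step1_choice_sqr_le Cx)[alpha [/andP[aa ab]]].
rewrite ler_pdivrMl// => h.
have h1 := sqr_norm_le_dotp (w - x).
have h2 := norm_dotp_le (gradient f x) (w - x).
have h3 : `|w - x| ^+ 2 <= 2 * mu p * alpha_max p * n%:R * `|gradient f x| * `|w - x|.
  apply: (le_trans h1); apply: (le_trans h).
  apply: (@le_trans _ _ (mu p * (2 * alpha * (n%:R * `|gradient f x| * `|w - x|)))).
    rewrite ler_pM2l// -mulrN ler_wpM2l//; first by lra.
    by rewrite (le_trans _ h2)// -normrN ler_norm.
  set t := n%:R * _ * _.
  have t0 : 0 <= t by rewrite !mulr_ge0.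
  have -> : mu p * (2 * alpha * t) = 2 * mu p * t * alpha by ring.
  have -> : 2 * mu p * alpha_max p * n%:R * `|gradient f x| * `|w - x|
     = 2 * mu p * t * alpha_max p by rewrite /t; ring.
  by rewrite ler_wpM2l// !mulr_ge0// ltW.
have [->|wx] := eqVneq (w - x) 0; first by rewrite normr0 !mulr_ge0// ltW// (lt_le_trans a0).
by move: h3; rewrite expr2 ler_pM2r// normr_gt0.
Qed.

Hypothesis convC : convex_set C.

Lemma convex_set_segment x y (t : R) : C x -> C y -> 0 < t <= 1 ->
  C (x + t *: (y - x)).
Proof.
move=> Cx Cy /andP[t0 t1].
have t01 : Itv.spec (@Itv.num_sem R) (Itv.Real `[0%Z, 1%Z]) t.
  by rewrite /Itv.spec/= /Itv.num_sem/= num_real in_itv/= (ltW t0) t1.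
pose l : {i01 R} := Itv.mk t01.
have := convC l (mem_set Cy) (mem_set Cx); rewrite inE.
congr C; rewrite /conv/=.
by rewrite scalerBr scalerBl scale1r addrC addrA addrAC.
Qed.

(** Testing against [x + t (y - x)] leaves [0 <= 2 alpha t <g, y - x> + mu t^2 <y - x, y - x>],
    whose linear coefficient must be nonnegative. *)
Lemma step1_choice_stop x : C x -> step1_choice C f p x x -> stationary C f x.
Proof.
have [_ /andP[z0 _] _ _ [a0 _ m1]] := p_ok.
move=> Cx hx; split => // y Cy.
(* [alpha] is obtained after [t], so the quadratic coefficient is taken with [alpha_min],
   independent of [t]. *)
apply: (@quadratic_ge0_linear_ge0 _ (mu p * dotp (y - x) (y - x) / (2 * alpha_min p))) => t t01.
have [alpha [zeta [/andP[aa _] /andP[zz _]]]] := step1_choice_le (convex_set_segment Cx Cy t01) hx.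
have -> : x + t *: (y - x) - x = t *: (y - x) by rewrite addrC addKr.
rewrite subrr !dotp0r !mulr0 addr0 !(dotpZl,dotpZr).
have zpos : 0 < zeta by rewrite (lt_trans z0).
rewrite pmulr_rge0// => h.
have alpha0 : 0 < 2 * alpha by lra.
have t0 : 0 < t by case/andP: t01.
have sq0 : 0 <= mu p * dotp (y - x) (y - x).
  by rewrite mulr_ge0 ?dotpp_ge0// (le_trans _ m1).
set b := dotp (gradient f x) _ in h *; set q := mu p * _ in sq0 *.
have hq : q / (2 * alpha) <= q / (2 * alpha_min p).
  by rewrite ler_wpM2l// lef_pV2// ?posrE//; lra.
have : 0 <= t * b + t ^+ 2 * (q / (2 * alpha)).
  rewrite -(pmulr_rge0 _ alpha0) (le_trans h)// le_eqVlt; apply/predU1P; left.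
  by rewrite /q; field; rewrite gt_eqF//; lra.
have : t ^+ 2 * (q / (2 * alpha)) <= t ^+ 2 * (q / (2 * alpha_min p)).
  by rewrite ler_wpM2l// sqr_ge0.
lra.
Qed.

(** Testing against [x + t (y - x)] for a fixed small [t] makes the negative linear term dominate
    the quadratic one; continuity carries this from [xbar] to nearby [x], uniformly in [alpha],
    [zeta], [D] and [w]. *)
Lemma step1_choice_uniform_descent xbar y : {for xbar, continuous (gradient f)} ->
  C y -> dotp (gradient f xbar) (y - xbar) < 0 ->
  exists2 eta, 0 < eta & \forall x \near xbar, forall w, C x ->
    step1_choice C f p x w -> dotp (gradient f x) (w - x) <= - eta.
Proof.
have [_ /andP[z0 _] _ _ [a0 _ m1]] := p_ok.
move=> cg Cy neg; set c := - dotp (gradient f xbar) (y - xbar).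
have c0 : 0 < c by rewrite oppr_gt0.
have m0 : 0 < mu p by rewrite (lt_le_trans _ m1).
(* [M] bounds [mu <y - x, y - x>] near [xbar]. *)
pose M := mu p * (dotp (y - xbar) (y - xbar) + 1).
have M0 : 0 < M by rewrite mulr_gt0// ltr_wpDl ?dotpp_ge0.
have cyx : y - x @[x --> nbhs xbar] --> y - xbar.
  by apply: (@continuousB _ 'rV[R]_n _ (cst y) id xbar) => //; exact: cst_continuous.
have near1 : \forall x \near xbar, dotp (gradient f x) (y - x) < - c / 2.
  have h : dotp (gradient f x) (y - x) @[x --> nbhs xbar] -->
      dotp (gradient f xbar) (y - xbar) by exact: cvg_dotp.
  by apply: (cvgr_lt _ h); rewrite /c opprK; lra.
have near2 : \forall x \near xbar, dotp (y - x) (y - x) < dotp (y - xbar) (y - xbar) + 1.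
  have h : dotp (y - x) (y - x) @[x --> nbhs xbar] -->
      dotp (y - xbar) (y - xbar) by exact: cvg_dotp.
  by apply: (cvgr_lt _ h); rewrite ltrDl.
(* Small enough that the quadratic term costs at most half of the linear gain [alpha * t * c]. *)
pose t := Num.min 1 (alpha_min p * c / (2 * M)).
have t0 : 0 < t by rewrite lt_min ltr01/= divr_gt0// mulr_gt0.
have t1 : t <= 1 by rewrite ge_min lexx.
have tM : t * M <= alpha_min p * c / 2.
  have -> : alpha_min p * c / 2 = alpha_min p * c / (2 * M) * M.
    by field; rewrite gt_eqF.
  by rewrite ler_pM2r// ge_min lexx orbT.
(* Dividing [zeta * alpha * t * c / 2] by [2 * alpha] and using [zeta_min < zeta] gives this
   value. *)
exists (zeta_min p * t * c / 4); first by rewrite !mulr_gt0.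
near=> x => w Cx hw.
have t01 : 0 < t <= 1 by rewrite t0 t1.
have [alpha [zeta [/andP[aa _] /andP[zz _]]]] := step1_choice_le (convex_set_segment Cx Cy t01) hw.
have -> : x + t *: (y - x) - x = t *: (y - x) by rewrite addrC addKr.
rewrite !(dotpZl,dotpZr).
have h1 : dotp (gradient f x) (y - x) < - c / 2 by near: x.
have h2 : mu p * dotp (y - x) (y - x) <= M.
  by rewrite ler_pM2l//; apply/ltW; near: x.
have h3 : 0 <= (mu p)^-1 * dotp (w - x) (w - x).
  by rewrite mulr_ge0 ?dotpp_ge0// invr_ge0 ltW.
set q := dotp (y - x) (y - x) in h2 *; set b := dotp (gradient f x) (y - x) in h1 *.
set d := dotp (gradient f x) (w - x) => h.
have h4 : mu p * (t * (t * q)) + 2 * alpha * (t * b) <= - (alpha * t * c / 2).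
  have : t * (mu p * q * t) <= t * (alpha_min p * c / 2).
    by rewrite ler_pM2l// (le_trans _ tM)// mulrC ler_pM2l.
  have : t * alpha_min p * c <= t * alpha * c by rewrite ler_pM2r// ler_pM2l.
  have : 2 * alpha * t * b <= 2 * alpha * t * (- c / 2).
    by rewrite ler_pM2l ?ltW// !mulr_gt0//; lra.
  nra.
have zpos : 0 < zeta by rewrite (lt_trans z0).
have alpha0 : 0 < alpha by rewrite (lt_le_trans a0).
have h5 : 2 * alpha * d <= zeta * - (alpha * t * c / 2).
  have := ler_wpM2l (ltW zpos) h4; lra.
have h6 : zeta_min p * (alpha * t * c / 2) <= zeta * (alpha * t * c / 2).
  by rewrite ler_wpM2r ?ltW// !mulr_gt0.
have alpha2 : 0 < 2 * alpha by rewrite mulr_gt0.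
rewrite -(ler_pM2l alpha2); lra.
Unshelve. all: by end_near.
Qed.

End Step1.

(** * Directional derivatives and the line search test *)

Section LineSearch.
Context {R : realType} {n : nat}.
Context {f : 'rV[R]_n -> R} {p : sgm_params R}.
Hypothesis f_C1 : continuously_differentiable f.
Implicit Types x w y d : 'rV[R]_n.

Lemma deriveE_gradient x d : 'D_d f x = dotp (gradient f x) d.
Proof.
have df := f_C1.1 x; rewrite deriveE// {1}(row_sum_delta d) linear_sum.
by apply: eq_bigr => i _; rewrite linearZ/= mxE deriveE// mulrC.
Qed.

Lemma is_derive_segment x d (t : R) :
  is_derive t 1 (fun t => f (x + t *: d)) (dotp (gradient f (x + t *: d)) d).
Proof.
have dfd : derivable f (x + t *: d) d by exact/diff_derivable/f_C1.1.
have E : (fun h => h^-1 *: (f (x + (h *: 1 + t) *: d) - f (x + t *: d)))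
    = (fun h => h^-1 *: (f (h *: d + (x + t *: d)) - f (x + t *: d))).
  by apply/funext => h; rewrite [h *: 1]mulr1 scalerDl addrCA.
apply: DeriveDef; first by rewrite /derivable/= E.
by rewrite -deriveE_gradient /derive/= E.
Qed.

Lemma mean_value_segment x d (t : R) : 0 < t ->
  exists2 c, 0 < c < t & f (x + t *: d) - f x = t * dotp (gradient f (x + c *: d)) d.
Proof.
move=> t0; have [||c] := @MVT R (fun t => f (x + t *: d))
  (fun t => dotp (gradient f (x + t *: d)) d) 0 t t0.
- by move=> c _; exact: is_derive_segment.
- apply: derivable_within_continuous => c _.
  by have [] := is_derive_segment x d c.
by rewrite in_itv/= scale0r addr0 subr0 mulrC => ct ->; exists c.
Qed.

(** Since [nu >= 0], rejection puts the mean slope over [[0, t]] above [sigma <g, d>]; the mean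
    value theorem realizes that slope at some [c]. *)
Lemma linesearch_rejected x nu w (t : R) : 0 < t -> 0 <= nu ->
  ~~ linesearch_test f p x nu w t ->
  exists2 c, 0 < c < t & sigma p * dotp (gradient f x) (w - x)
                         < dotp (gradient f (x + c *: (w - x))) (w - x).
Proof.
move=> t0 nu0; rewrite /linesearch_test -ltNge => ht.
have [c ct E] := mean_value_segment x (w - x) t0; exists c => //.
rewrite -(ltr_pM2l t0) -E; lra.
Qed.

(** The slope at 0 is strictly below [sigma <g, d>] because [<g, d> < 0] and [sigma < 1]; by
    continuity it remains so for small [t], which excludes rejection. *)
Lemma linesearch_accepts_small x nu w :
  0 < sigma p < 1 -> 0 <= nu -> dotp (gradient f x) (w - x) < 0 ->
  exists2 t0, 0 < t0 & forall t, 0 < t < t0 -> linesearch_test f p x nu w t.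
Proof.
move=> /andP[s0 s1] nu0 neg; set d := w - x.
have cseg : (fun t : R => x + t *: d) t @[t --> nbhs (0 : R)] --> x.
  have : (fun t : R => x + t *: d) t @[t --> nbhs (0 : R)] --> x + 0 *: d.
    by apply: cvgD; [exact: cvg_cst|apply: cvgZr_tmp; exact: cvg_id].
  by rewrite scale0r addr0.
have cg : gradient f (x + t *: d) @[t --> nbhs (0 : R)] --> gradient f x.
  exact: (cvg_comp _ _ cseg (f_C1.2 x)).
have cd : dotp (gradient f (x + t *: d)) d @[t --> nbhs (0 : R)] --> dotp (gradient f x) d.
  by apply: cvg_dotp => //; exact: cvg_cst.
have slt : dotp (gradient f x) d < sigma p * dotp (gradient f x) d by nra.
have /nbhs_ballP[t0 /= t00 ht0] :
    \forall t \near (0 : R), dotp (gradient f (x + t *: d)) d < sigma p * dotp (gradient f x) d.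
  exact: cvgr_lt cd _ slt.
exists t0 => // t /andP[tpos tlt]; apply/negPn/negP.
move=> /(linesearch_rejected tpos nu0)[c /andP[c0 ct]].
apply/negP; rewrite -leNgt; apply/ltW/ht0.
by rewrite -ball_normE/= sub0r normrN gtr0_norm// (lt_trans ct).
Qed.

End LineSearch.

(** * Executions: end of the line search and extraction of the iterates *)

Section Execution.
Context {R : realType} {n : nat}.
Context {C : set 'rV[R]_n} {f : 'rV[R]_n -> R} {p : sgm_params R}.
Context {x0 : 'rV[R]_n} {nu0 : R} {s : nat -> sgm_state R n}.
Hypothesis clC : closed C.
Hypothesis convC : convex_set C.
Hypothesis f_C1 : continuously_differentiable f.
Hypothesis p_ok : sgm_params_ok p.
Hypothesis s_exec : sgm_execution C f p x0 nu0 s.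
Implicit Types x w y d : 'rV[R]_n.
Implicit Types nu tau : R.

(** Loop invariant of backtracking; it hands the convergence proof a rejected trial comparable to
    the accepted one. *)
Definition rejected_before x nu w (tau : R) : Prop :=
  tau = 1 \/ exists tau', [/\ 0 < tau' <= 1, omega_lo p * tau' <= tau
                            & ~~ linesearch_test f p x nu w tau'].

(** One pass through Steps 1 to 3 without control states; the final bound makes [f + nu]
    nonincreasing. *)
Definition sgm_iteration x nu x' nu' : Prop :=
  exists w tau,
  [/\ step1_choice C f p x w /\ w <> x,
      0 < tau <= 1 /\ linesearch_test f p x nu w tau,
      rejected_before x nu w tau,
      x' = x + tau *: (w - x)
    & 0 <= nu' <= f x + nu - f x'].

Lemma sgm_step1_inv k x nu t : sgm_step C f p (AtStep1 k x nu) t ->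
  exists2 w, step1_choice C f p x w &
    (w = x /\ t = Stopped k x) \/ (w <> x /\ t = AtStep2 k x nu w 1).
Proof.
move=> st; inversion st as [? ? ? w hw wx|? ? ? w hw wx| | |]; subst.
  by exists x => //; left.
by exists w => //; right.
Qed.

Lemma sgm_step2_inv k x nu w tau t : sgm_step C f p (AtStep2 k x nu w tau) t ->
  (linesearch_test f p x nu w tau /\ t = AtStep3 k x nu (x + tau *: (w - x))) \/
  exists tau', [/\ ~~ linesearch_test f p x nu w tau,
    omega_lo p * tau <= tau' <= omega_hi p * tau & t = AtStep2 k x nu w tau'].
Proof.
move=> st; inversion st as [| |? ? ? ? ? ok|? ? ? ? ? tau' nok bd|]; subst.
  by left.
by right; exists tau'.
Qed.

Lemma sgm_step3_inv k x nu y t : sgm_step C f p (AtStep3 k x nu y) t ->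
  exists delta nu', [/\ delta_min p <= delta <= 1,
    0 <= nu' <= (1 - delta) * (f x + nu - f y) & t = AtStep1 k.+1 y nu'].
Proof.
move=> st; inversion st as [| | | |? ? ? ? delta nu' hd hnu]; subst.
by exists delta, nu'.
Qed.

(** A maximal execution rests only where nothing is possible, so [t] is just a witness; the step
    really taken may lead elsewhere. *)
Lemma exec_step i t : sgm_step C f p (s i) t -> sgm_step C f p (s i) (s i.+1).
Proof. by move=> st; have [//|[_ /(_ t)]] := s_exec.2 i. Qed.

(** Each rejection shrinks [tau] by a factor at most [omega_hi < 1], so the threshold of
    [linesearch_accepts_small] is passed after finitely many trials. *)
Lemma linesearch_run i k x nu w (tau : R) :
  0 <= nu -> dotp (gradient f x) (w - x) < 0 -> 0 < tau <= 1 ->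
  rejected_before x nu w tau -> s i = AtStep2 k x nu w tau ->
  exists j tau', [/\ s j = AtStep3 k x nu (x + tau' *: (w - x)),
    0 < tau' <= 1, linesearch_test f p x nu w tau' & rejected_before x nu w tau'].
Proof.
have [s01 _ _ [lo0 lohi hi1] _] := p_ok.
move=> nu_ge0 neg; have [t0 t00 ht0] := linesearch_accepts_small f_C1 s01 nu_ge0 neg.
have hi0 : 0 < omega_hi p by rewrite (lt_trans lo0).
have [N hN] : exists N, omega_hi p ^+ N < t0.
  have : `|omega_hi p| < 1 by rewrite gtr0_norm.
  move=> /cvg_expr/cvgrPdist_lt/(_ _ t00)[N _ /(_ N (leqnn N))].
  by rewrite sub0r normrN ger0_norm ?exprn_ge0 ?(ltW hi0)//; exists N.
move=> /andP[tau0 tau1].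
have : omega_hi p ^+ N * tau < t0.
  by rewrite (le_lt_trans _ hN)// ger_pMr// exprn_gt0.
(* [N] bounds the rejections still to come: each one trades a factor [omega_hi] for a decrease of
   [N]. *)
elim: N {hN} i tau tau0 tau1 => [|N IH] i tau tau0 tau1 small rej si.
  have ok : linesearch_test f p x nu w tau.
    by apply: ht0; rewrite tau0 -[tau]mul1r.
  have := @exec_step i (AtStep3 k x nu (x + tau *: (w - x))).
  rewrite si => /(_ (SGM_accept _ _ ok)) st.
  have [[_ sSi]|[tau' []]] := sgm_step2_inv st; last by rewrite ok.
  by exists i.+1, tau; split => //; rewrite tau0.
have [ok|nok] := boolP (linesearch_test f p x nu w tau).
  have := @exec_step i (AtStep3 k x nu (x + tau *: (w - x))).
  rewrite si => /(_ (SGM_accept _ _ ok)) st.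
  have [[_ sSi]|[tau' []]] := sgm_step2_inv st; last by rewrite ok.
  by exists i.+1, tau; split => //; rewrite tau0.
have hb : omega_lo p * tau <= omega_lo p * tau <= omega_hi p * tau.
  by rewrite lexx ler_wpM2r// ltW.
(* The least admissible trial shows that a step exists; inversion then recovers the trial actually
   chosen. *)
have := @exec_step i (AtStep2 k x nu w (omega_lo p * tau)).
rewrite si => /(_ (SGM_backtrack _ _ nok hb)) st.
have [[ok _]|[tau' [_ /andP[b1 b2] sSi]]] := sgm_step2_inv st.
  by rewrite ok in nok.
apply: (IH i.+1 tau') => //.
- by rewrite (lt_le_trans _ b1)// mulr_gt0.
- by rewrite (le_trans b2)// mulr_ile1// ltW.
- by rewrite (le_lt_trans _ small)// exprSr -mulrA ler_pM2l// exprn_gt0.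
- by right; exists tau; split => //; rewrite tau0.
Qed.

Lemma iteration_run i k x nu : C x -> 0 <= nu -> s i = AtStep1 k x nu ->
  (exists j, s j = Stopped k x /\ stationary C f x) \/
  exists j x' nu', s j = AtStep1 k.+1 x' nu' /\ sgm_iteration x nu x' nu'.
Proof.
have [/andP[s0 s1] _ /andP[d0 d1] _ _] := p_ok.
move=> Cx nu_ge0 si; have [w hw] := step1_choice_exists (f := f) clC p_ok Cx.
have : sgm_step C f p (s i) (s i.+1).
  have [wx|wx] := pselect (w = x).
    by apply: (@exec_step i (Stopped k x)); rewrite si; exact: SGM_stop hw wx.
  by apply: (@exec_step i (AtStep2 k x nu w 1)); rewrite si; exact: SGM_direction hw wx.
rewrite si => /sgm_step1_inv[w' hw' [[wx sSi]|[wx sSi]]].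
  left; exists i.+1; split => //; rewrite wx in hw'.
  exact: (step1_choice_stop clC p_ok convC Cx hw').
right; have neg := step1_choice_descent clC p_ok Cx hw' wx.
have [|j [tau [sj tau01 ok rej]]] := linesearch_run nu_ge0 neg _ (or_introl erefl) sSi.
  by rewrite ltr01 lexx.
have /andP[tau0 tau1] := tau01.
set y := x + tau *: (w' - x) in sj *.
(* Nonnegativity lets the factor [1 - delta <= 1] be dropped from the bound on [nu'] below. *)
have decr : 0 <= f x + nu - f y.
  move: ok; rewrite /linesearch_test -/y.
  have : sigma p * tau * dotp (gradient f x) (w' - x) <= 0.
    by rewrite nmulr_lle0 // mulr_ge0// ltW.
  lra.
have st3 : sgm_step C f p (s j) (s j.+1).
  apply: (@exec_step _ (AtStep1 k.+1 y 0)); rewrite sj.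
  (* With [delta = 1] the value 0 is admissible for the next [nu], so Step 3 can always proceed. *)
  apply: (@SGM_update _ _ _ _ _ _ _ _ _ 1); first by rewrite ltW ?lexx.
  by rewrite subrr mul0r lexx.
rewrite sj in st3.
have [delta [nu' [/andP[dd dd1] /andP[nu'0 nu'le] sSj]]] := sgm_step3_inv st3.
exists j.+1, y, nu'; split=> //; exists w', tau; split => //.
rewrite nu'0 (le_trans nu'le)// ler_piMl//; lra.
Qed.

(** Without a stop, [iteration_run] applies again and again, and dependent choice assembles the
    sequences. *)
Lemma exec_dichotomy : C x0 -> 0 <= nu0 ->
  (exists i k x, s i = Stopped k x /\ stationary C f x) \/
  exists (x : nat -> 'rV[R]_n) (nu : nat -> R),
    [/\ sgm_generates s x nu, forall k, C (x k), forall k, 0 <= nu k &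
    forall k, sgm_iteration (x k) (nu k) (x k.+1) (nu k.+1)].
Proof.
move=> Cx0 nu0_ge0; have [stop|nostop] :=
  pselect (exists i k x, s i = Stopped k x /\ stationary C f x); [by left|right].
(* Position in [s], counter, iterate and [nu], bundled with the invariants that [iteration_run]
   requires. *)
pose T := {t : nat * nat * 'rV[R]_n * R |
  [/\ s t.1.1.1 = AtStep1 t.1.1.2 t.1.2 t.2, C t.1.2 & 0 <= t.2]}.
pose next (t t' : T) := (sval t').1.1.2 = (sval t).1.1.2.+1 /\
  sgm_iteration (sval t).1.2 (sval t).2 (sval t').1.2 (sval t').2.
have step (t : T) : {t' : T | next t t'}.
  apply: cid; case: t => -[[[i k] x] nu] /= [si Cx nu_ge0].
  have [[j hj]|[j [x' [nu' [sj it]]]]] := iteration_run Cx nu_ge0 si.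
    by case: nostop; exists j, k, x.
  have Cx' : C x'.
    case: it => w [tau [[hw _] [tau01 _] _ -> _]].
    exact: (convex_set_segment convC Cx (step1_choice_in hw) tau01).
  have nu'0 : 0 <= nu' by case: it => w [tau [_ _ _ _ /andP[]]].
  by exists (exist _ (j, k.+1, x', nu') (And3 sj Cx' nu'0)).
have [h [h0 hS]] := dependent_choice step (exist _ (0%N, 0%N, x0, nu0) (And3 s_exec.1 Cx0 nu0_ge0)).
(* The choice index is thus the iteration number that [sgm_generates] asks for. *)
have hk m : (sval (h m)).1.1.2 = m.
  by elim: m => [|m IH]; [rewrite h0 | rewrite (hS m).1 IH].
exists (fun m => (sval (h m)).1.2), (fun m => (sval (h m)).2); split.
- move=> m; exists (sval (h m)).1.1.1.
  by have [-> _ _] := svalP (h m); rewrite hk.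
- by move=> m; have [] := svalP (h m).
- by move=> m; have [] := svalP (h m).
- by move=> m; have [] := hS m.
Qed.

End Execution.

(** * Cluster points of an infinite run *)

Section Convergence.
Context {R : realType} {n : nat}.
Context {C : set 'rV[R]_n} {f : 'rV[R]_n -> R} {p : sgm_params R}.
Context {x : nat -> 'rV[R]_n} {nu : nat -> R}.
Hypothesis clC : closed C.
Hypothesis convC : convex_set C.
Hypothesis f_C1 : continuously_differentiable f.
Hypothesis p_ok : sgm_params_ok p.
Hypothesis xC : forall k, C (x k).
Hypothesis nu_ge0 : forall k, 0 <= nu k.
Hypothesis iter : forall k,
  @sgm_iteration R n C f p (x k) (nu k) (x k.+1) (nu k.+1).
Hypothesis nu_cvg0 : nu k @[k --> \oo] --> 0.

(* [f (x k) + nu k] is nonincreasing even though [f (x k)] need not be. *)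
Lemma cvg_decrease : argmin f C !=set0 ->
  f (x k) + nu k - f (x k.+1) @[k --> \oo] --> 0.
Proof.
move=> [z [Cz zmin]]; pose e k := f (x k) + nu k.
have e_cvg : cvgn e.
  apply: nonincreasing_is_cvgn.
    apply/nonincreasing_seqP => k; rewrite /e.
    by have [w [tau [_ _ _ _ /andP[_]]]] := iter k; lra.
  exists (f z) => _ [k _ <-]; rewrite /e.
  by have := zmin _ (xC k); have := nu_ge0 k; lra.
(* Consecutive differences of the convergent [e], plus a null sequence. *)
have -> : (fun k => f (x k) + nu k - f (x k.+1)) = (fun k => e k - e k.+1 + nu k.+1).
  by apply/funext => k; rewrite /e; ring.
have -> : (0 : R) = limn e - limn e + 0 by rewrite subrr addr0.
apply: cvgD; last by rewrite (cvg_shiftS nu).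
by apply: cvgB => //; rewrite (cvg_shiftS e).
Qed.

Lemma cluster_stationary xbar : argmin f C !=set0 ->
  cluster (x k @[k --> \oo]) xbar -> stationary C f xbar.
Proof.
have [/andP[s0 s1] _ _ [lo0 _ _] [a0 a1 m1]] := p_ok.
move=> fmin clx; split.
  apply: clC => B nB; apply: clx => //.
  by exists 0%N => // k _; exact: xC.
move=> y Cy; rewrite leNgt; apply/negP => neg.
have cg := f_C1.2 xbar.
have [eta eta0 near_descent] := step1_choice_uniform_descent clC p_ok convC cg Cy neg.
(* [G] will bound the gradient near [xbar], and [K] the directions there. *)
pose G := `|gradient f xbar| + 1.
have G0 : 0 < G by rewrite ltr_wpDl.
pose K := 2 * mu p * alpha_max p * n%:R * G + 1.
have m0 : 0 < mu p by rewrite (lt_le_trans _ m1).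
have amax0 : 0 < alpha_max p by rewrite (lt_le_trans a0).
have K0 : 0 < K by rewrite ltr_wpDl// !mulr_ge0// ltW.
(* Chosen so that [n.+1 * (2 * eps) * K = (1 - sigma) * eta]; [n.+1] keeps the divisor positive in
   dimension 0. *)
pose eps := (1 - sigma p) * eta / (2 * (n.+1%:R * K)).
have nK0 : 0 < n.+1%:R * K by rewrite mulr_gt0.
have eps0 : 0 < eps by rewrite divr_gt0 ?mulr_gt0// subr_gt0.
have near_grad a : 0 < a -> \forall z \near xbar, `|gradient f xbar - gradient f z| < a.
  by move=> agt0; move/cvgrPdist_lt: cg; exact.
have near_G : \forall z \near xbar, `|gradient f z| < G.
  apply: filterS (near_grad 1 ltr01) => z; rewrite distrC => h1.
  by have := lerB_dist (gradient f z) (gradient f xbar); rewrite /G; lra.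
have /nbhs_ballP[r /= r0 hr] := near_grad _ eps0.
(* A step below [b] moves the point by less than [r / 2], and [b <= 1] rules out [tau = 1] later. *)
pose b := Num.min 1 (r / (2 * K)).
have b0 : 0 < b by rewrite lt_min ltr01/= divr_gt0// mulr_gt0.
(* A decrease below [e] will force [tau < omega_lo * b]. *)
pose e := sigma p * eta * (omega_lo p * b).
have e0 : 0 < e by rewrite !mulr_gt0.
have dec : \forall k \near \oo, f (x k) + nu k - f (x k.+1) < e.
  exact: (cvgr_lt _ (cvg_decrease fmin) _ e0).
(* Cluster points are tested by sets of points; this set lets the index [k] be recovered from the
   point. *)
have dec_x : (x k @[k --> \oo])
    [set z | exists2 k, f (x k) + nu k - f (x k.+1) < e & x k = z].
  by apply: filterS dec => k ?; exists k.
have near_ball : \forall z \near xbar, ball xbar (r / 2) z.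
  by apply: nbhsx_ballx; rewrite divr_gt0.
(* One index with both small decrease and [x k] close to [xbar] suffices for the contradiction. *)
have [_ [[k hk <-]]] :=
  clx _ _ dec_x (filterI near_ball (filterI near_G near_descent)).
move=> [xk_r [xk_G]] xk_eta.
have [w [tau [[hw _] [/andP[tau0 tau1] ok] rej x' _]]] := iter k.
set d := w - x k; have hd : dotp (gradient f (x k)) d <= - eta := xk_eta _ (xC k) hw.
have dK : `|d| <= K.
  have := step1_choice_norm_le clC p_ok (xC k) hw; rewrite -/d => /le_trans; apply.
  apply: (@le_trans _ _ (2 * mu p * alpha_max p * n%:R * G)); last by rewrite lerDl.
  by rewrite ler_wpM2l ?(ltW xk_G)// !mulr_ge0// ltW.
have tau_small : tau < omega_lo p * b.
  have : sigma p * eta * tau < e.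
    move: ok; rewrite /linesearch_test -x' -/d => ok.
    rewrite (le_lt_trans _ hk)//.
    have : sigma p * tau * eta <= sigma p * tau * - dotp (gradient f (x k)) d.
      by rewrite ler_pM2l ?mulr_gt0// lerNr.
    lra.
  by rewrite ltr_pM2l// mulr_gt0.
have [_ _ _ [_ lohi hi1] _] := p_ok.
have b1 : b <= 1 by rewrite ge_min lexx.
case: rej => [tau_eq1|[tau' [/andP[tau'0 tau'1] lotau']]].
  by move: tau_small; rewrite tau_eq1; nra.
have tau'b : tau' < b by rewrite -(ltr_pM2l lo0) (le_lt_trans lotau').
move=> /(linesearch_rejected f_C1 tau'0 (nu_ge0 k))[c /andP[c0 ctau']].
rewrite -/d => hc; set z := x k + c *: d in hc.
have cK : `|c *: d| < r / 2.
  rewrite normrZ gtr0_norm//.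
  apply: (@le_lt_trans _ _ (c * K)); first by rewrite ler_pM2l.
  have : b * K <= r / 2.
    rewrite (_ : r / 2 = r / (2 * K) * K); last by field; rewrite gt_eqF.
    by rewrite ler_pM2r// ge_min lexx orbT.
  by apply: lt_le_trans; rewrite ltr_pM2r// (lt_trans ctau').
have z_near : `|gradient f xbar - gradient f z| < eps.
  apply: hr; rewrite -ball_normE/= /z opprD addrA.
  move: xk_r; rewrite -ball_normE/= => xk_r.
  by rewrite (le_lt_trans (ler_normB _ _))//; lra.
have x_near : `|gradient f xbar - gradient f (x k)| < eps.
  apply: hr; move: xk_r; rewrite -!ball_normE/=; lra.
(* Both gradients lie within [eps] of that at [xbar], whereas the rejection [hc] forces this
   difference above [(1 - sigma) * eta]. *)
have gz : dotp (gradient f z) d - dotp (gradient f (x k)) d < (1 - sigma p) * eta.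
  rewrite -dotpNl -dotpDl (le_lt_trans (ler_norm _))//.
  rewrite (le_lt_trans (norm_dotp_le _ _))//.
  have gd : `|gradient f z - gradient f (x k)| < 2 * eps.
    rewrite -(subrKA (gradient f xbar)) (le_lt_trans (ler_normD _ _))//.
    by rewrite distrC; lra.
  have -> : (1 - sigma p) * eta = n.+1%:R * (2 * eps) * K.
    by rewrite /eps; field; rewrite ?gt_eqF// ?andbT ?pnatr_eq0.
  apply: (@le_lt_trans _ _ (n%:R * `|gradient f z - gradient f (x k)| * K)).
    by rewrite ler_wpM2l// mulr_ge0.
  rewrite ltr_pM2r//.
  apply: (@le_lt_trans _ _ (n.+1%:R * `|gradient f z - gradient f (x k)|)).
    by rewrite ler_wpM2r// ler_nat.
  by rewrite ltr_pM2l.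
nra.
Qed.

End Convergence.

Theorem proposition11 (R : realType) (n : nat) (C : set 'rV[R]_n)
    (f : 'rV[R]_n -> R) (p : sgm_params R) (x0 : 'rV[R]_n) (nu0 : R)
    (s : nat -> sgm_state R n) :
  C !=set0 -> closed C -> convex_set C ->
  continuously_differentiable f ->
  argmin f C !=set0 ->
  sgm_params_ok p -> C x0 -> 0 <= nu0 ->
  sgm_execution C f p x0 nu0 s ->
  (forall (x : nat -> 'rV[R]_n) (nu : nat -> R),
      sgm_generates s x nu -> nu k @[k --> \oo] --> 0) ->
  (exists (i k : nat) (x : 'rV[R]_n), s i = Stopped k x /\ stationary C f x)
  \/ (exists (x : nat -> 'rV[R]_n) (nu : nat -> R),
        sgm_generates s x nu /\
        forall xbar : 'rV[R]_n, cluster (x k @[k --> \oo]) xbar ->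
          stationary C f xbar).
Proof.
move=> _ clC convC f_C1 fmin p_ok Cx0 nu0_ge0 s_exec nu_cvg.
have [stop|[x [nu [gen xC nu_ge0 iter]]]] :=
  exec_dichotomy clC convC f_C1 p_ok s_exec Cx0 nu0_ge0; first by left.
right; exists x, nu; split => // xbar.
(* The hypothesis on [nu] concerns generated sequences, so [gen] supplies the limit. *)
exact: (cluster_stationary clC convC f_C1 p_ok xC nu_ge0 iter (nu_cvg _ _ gen)).
Qed.
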